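(* Let $\mathcal A$ be an associative unital algebra over $\mathbb C$, let $A_0,A_1\in\mathcal A$, let $\alpha,\alpha_1,\beta,\gamma,\gamma_1\in\mathbb C$, and set $$A_2=[A_0,A_1],\qquad A_3=[A_0,[A_0,A_1]],\qquad A_4=[A_1,[A_1,A_0]].$$ Then the pair of tridiagonal relations $$[A_0,\;A_0^2A_1+A_1A_0^2-\beta A_0A_1A_0-\gamma(A_0A_1+A_1A_0)-\alpha A_1]=0,$$ $$[A_1,\;A_1^2A_0+A_0A_1^2-\beta A_1A_0A_1-\gamma_1(A_0A_1+A_1A_0)-\alpha_1A_0]=0$$ is equivalent to the pair of relations $$[A_0,[A_0,[A_0,A_1]]]=(2-\beta)(A_0A_3-A_0^2A_2)+2\gamma A_0A_2-\gamma A_3+\alpha A_2,$$ $$[A_1,[A_1,[A_1,A_0]]]=(2-\beta)(A_1A_4+A_1^2A_2)-2\gamma_1A_1A_2-\gamma_1A_4-\alpha_1A_2 .$$ In particular the tridiagonal algebra (and hence, for $\gamma=\gamma_1=0$ and $\beta=q+q^{-1}$, the algebra of the $q$-deformed Dolan--Grady relations) is a quasi-linear algebra of type $(2,3)$, with basic operators $A_0,A_1$ and extension operators $A_2,A_3,A_4$.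
   Context: $[A,B]=AB-BA$. Here ''quasi-linear of type $(2,3)$ with basic operators $A_0,A_1$ and extension operators $A_2,A_3,A_4$'' means: each of the commutators $[A_0,A_1],[A_0,A_2],[A_0,A_3]$ is of the form $p_1(A_0)A_1+p_2(A_0)A_2+p_3(A_0)A_3+p_0(A_0)$ with polynomials $p_j$, and each of the commutators $[A_1,A_0],[A_1,A_2],[A_1,A_4]$ is of the form $r_1(A_1)A_0+r_2(A_1)A_2+r_3(A_1)A_4+r_0(A_1)$ with polynomials $r_j$. The $q$-deformed Dolan--Grady relations are $[A_0,[A_0,[A_0,A_1]_q]_{q^{-1}}]=\alpha[A_0,A_1]$ and $[A_1,[A_1,[A_1,A_0]_q]_{q^{-1}}]=\alpha_1[A_1,A_0]$ with $[X,Y]_q=q^{1/2}XY-q^{-1/2}YX$. *)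

(* Defs.v *)
From HB Require Import structures.
From mathcomp Require Import all_boot all_order all_algebra.
From mathcomp Require Import boolp reals.
From mathcomp Require Import complex monalg.

Set Implicit Arguments.
Unset Strict Implicit.
Unset Printing Implicit Defensive.

Import GRing.Theory.
Import Quotient.Exports.

Local Open Scope ring_scope.
Local Open Scope quotient_scope.

Definition comr (A : pzRingType) (X Y : A) : A := X * Y - Y * X.

Notation "[: X , Y :]" := (comr X Y)
  (at level 0, X at level 99, Y at level 99, format "[:  X ,  Y  :]")
  : ring_scope.

Section Relations.
Variables (K : fieldType) (A : algType K).
Implicit Types X Y : A.

(* The tridiagonal relation of X on Y; the second one of the pair is obtained
   by exchanging the two operators. *)
Definition tridiag (beta gamma alpha : K) X Y : A :=
  [: X, X ^+ 2 * Y + Y * X ^+ 2 - beta *: (X * Y * X)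
        - gamma *: (X * Y + Y * X) - alpha *: Y :].

Definition tridiag_rels (alpha alpha1 beta gamma gamma1 : K) (A0 A1 : A) :
    Prop :=
  tridiag beta gamma alpha A0 A1 = 0 /\ tridiag beta gamma1 alpha1 A1 A0 = 0.

(* [X, Y]_q, where s is a chosen square root q^(1/2).  The matching square
   root of q^-1 is s^-1, so that [X, Y]_(q^-1) is qcomr s^-1 X Y. *)
Definition qcomr (s : K) X Y : A := s *: (X * Y) - s^-1 *: (Y * X).

Definition qDG_rels (s alpha alpha1 : K) (A0 A1 : A) : Prop :=
  [: A0, qcomr s^-1 A0 (qcomr s A0 A1) :] = alpha *: [: A0, A1 :] /\
  [: A1, qcomr s^-1 A1 (qcomr s A1 A0) :] = alpha1 *: [: A1, A0 :].

(* Z = p1(X) Y1 + p2(X) Y2 + p3(X) Y3 + p0(X) for some polynomials p_j. *)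
Definition quasi_linear_form (X Y1 Y2 Y3 Z : A) : Prop :=
  exists p0 p1 p2 p3 : {poly K},
    Z = horner_alg X p1 * Y1 + horner_alg X p2 * Y2
        + horner_alg X p3 * Y3 + horner_alg X p0.

Definition quasi_linear23 (A0 A1 A2 A3 A4 : A) : Prop :=
  [/\ quasi_linear_form A0 A1 A2 A3 [: A0, A1 :],
      quasi_linear_form A0 A1 A2 A3 [: A0, A2 :] &
      quasi_linear_form A0 A1 A2 A3 [: A0, A3 :]] /\
  [/\ quasi_linear_form A1 A0 A2 A4 [: A1, A0 :],
      quasi_linear_form A1 A0 A2 A4 [: A1, A2 :] &
      quasi_linear_form A1 A0 A2 A4 [: A1, A4 :]].

End Relations.

Section Morphisms.
Variables (K : fieldType) (A B : algType K) (f : {lrmorphism A -> B}).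

Lemma lrmorph_comr X Y : f [: X, Y :] = [: f X, f Y :].
Proof. by rewrite rmorphB !rmorphM. Qed.

Lemma lrmorph_scale c X : f (c *: X) = c *: f X.
Proof. exact: linearZZ. Qed.

Lemma lrmorph_tridiag beta gamma alpha X Y :
  f (tridiag beta gamma alpha X Y) = tridiag beta gamma alpha (f X) (f Y).
Proof.
rewrite /tridiag lrmorph_comr !(rmorphB f) /= !lrmorph_scale (rmorphD f) (rmorphD f (X * Y)).
by rewrite !rmorphM.
Qed.

Lemma lrmorph_qcomr s X Y : f (qcomr s X Y) = qcomr s (f X) (f Y).
Proof. by rewrite rmorphB /= !lrmorph_scale !rmorphM. Qed.

End Morphisms.

Section TwoSidedIdeal.
Variables (A : nzRingType) (S : A -> Prop).

Inductive ideal_gen : A -> Prop :=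
| Ideal0 : ideal_gen 0
| IdealG a s b : S s -> ideal_gen (a * s * b)
| IdealD x y : ideal_gen x -> ideal_gen y -> ideal_gen (x + y).

Lemma ideal_genMl a x : ideal_gen x -> ideal_gen (a * x).
Proof.
elim=> [|c s b Ss|u v _ Hu _ Hv]; rewrite ?mulr0 ?mulrDr.
- exact: Ideal0.
- by rewrite !mulrA; exact: IdealG.
- exact: IdealD.
Qed.

Lemma ideal_genMr a x : ideal_gen x -> ideal_gen (x * a).
Proof.
elim=> [|c s b Ss|u v _ Hu _ Hv]; rewrite ?mul0r ?mulrDl.
- exact: Ideal0.
- by rewrite -mulrA; exact: IdealG.
- exact: IdealD.
Qed.

Definition ideal_pred (x : A) : bool := `[< ideal_gen x >].

Lemma ideal_pred_zmod_closed : zmod_closed ideal_pred.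
Proof.
split=> [|x y /asboolP Hx /asboolP Hy]; apply/asboolP; first exact: Ideal0.
by apply: IdealD => //; rewrite -mulN1r; exact: ideal_genMl.
Qed.

HB.instance Definition _ :=
  GRing.isZmodClosed.Build A ideal_pred ideal_pred_zmod_closed.

Definition ideal_zmod : zmodClosed A :=
  GRing.ZmodClosed.clone A ideal_pred _.

End TwoSidedIdeal.

(* The quotient of A by the two-sided ideal generated by S.  Rings being
   nontrivial, that ideal has to be proper. *)
Definition alg_quot (K : fieldType) (A : algType K) (S : A -> Prop)
  (properS : ~ ideal_gen S 1) : Type := Quotient.quot (ideal_zmod S).

Section AlgQuotient.
Variables (K : fieldType) (A : algType K) (S : A -> Prop).
Variable properS : ~ ideal_gen S 1.

Local Notation Q := (alg_quot properS).

HB.instance Definition _ := GRing.Zmodule.on Q.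
HB.instance Definition _ := EqQuotient.on Q.

Definition alg_proj (x : A) : Q := \pi_Q x.

Lemma alg_projP x y : alg_proj x = alg_proj y <-> ideal_gen S (x - y).
Proof.
split=> [/eqP|H]; last apply/eqP; rewrite -?Quotient.idealrBE.
  by move/asboolP.
exact/asboolP.
Qed.

Lemma alg_projK (x : Q) : alg_proj (repr x) = x. Proof. exact: reprK. Qed.

Lemma alg_repr x : ideal_gen S (repr (alg_proj x) - x).
Proof. by apply/alg_projP; rewrite alg_projK. Qed.

Lemma alg_projD : {morph alg_proj : x y / x + y}.
Proof. by move=> x y; rewrite /alg_proj; exact: Quotient.pi_add. Qed.

Let one : Q := alg_proj 1.
Let mul (x y : Q) : Q := alg_proj (repr x * repr y).
Let scale (c : K) (x : Q) : Q := alg_proj (c *: repr x).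

Let projM x y : mul (alg_proj x) (alg_proj y) = alg_proj (x * y).
Proof.
apply/alg_projP; set x' := repr _; set y' := repr _.
have -> : x' * y' - x * y = (x' - x) * y' + x * (y' - y).
  by rewrite mulrBl mulrBr addrA subrK.
by apply: IdealD; [apply: ideal_genMr|apply: ideal_genMl]; exact: alg_repr.
Qed.

Let projZ c x : scale c (alg_proj x) = alg_proj (c *: x).
Proof.
apply/alg_projP; rewrite -scalerBr -mulr_algl.
by apply: ideal_genMl; exact: alg_repr.
Qed.

Let mulA : associative mul.
Proof.
by move=> x y z; rewrite -[x]alg_projK -[y]alg_projK -[z]alg_projK !projM mulrA.
Qed.

Let mul1 : left_id one mul.
Proof. by move=> x; rewrite -[x]alg_projK projM mul1r. Qed.

Let mulr1_ : right_id one mul.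
Proof. by move=> x; rewrite -[x]alg_projK projM mulr1. Qed.

Let mulDl : left_distributive mul +%R.
Proof.
move=> x y z; rewrite -[x]alg_projK -[y]alg_projK -[z]alg_projK.
by rewrite -alg_projD !projM mulrDl alg_projD.
Qed.

Let mulDr : right_distributive mul +%R.
Proof.
move=> x y z; rewrite -[x]alg_projK -[y]alg_projK -[z]alg_projK.
by rewrite -alg_projD !projM mulrDr alg_projD.
Qed.

Let one_neq0 : one != 0.
Proof.
apply/eqP; rewrite -[0](subrr (alg_proj 0)) -[X in _ - X]addr0.
have -> : alg_proj 0 - (alg_proj 0 + 0) = alg_proj 0.
  apply: (addIr (alg_proj 0)); rewrite addr0 subrK -alg_projD.
  by rewrite addr0.
by move/alg_projP; rewrite subr0.
Qed.

HB.instance Definition _ :=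
  GRing.Zmodule_isNzRing.Build Q mulA mul1 mulr1_ mulDl mulDr one_neq0.

Lemma alg_projM : {morph alg_proj : x y / x * y}.
Proof. by move=> x y; rewrite -projM. Qed.

Let scaleA a b v : scale a (scale b v) = scale (a * b) v.
Proof. by rewrite -[v]alg_projK !projZ scalerA. Qed.

Let scale1 : left_id 1 scale.
Proof. by move=> v; rewrite -[v]alg_projK projZ scale1r. Qed.

Let scaleDr : right_distributive scale +%R.
Proof.
move=> c x y; rewrite -[x]alg_projK -[y]alg_projK.
by rewrite -alg_projD !projZ scalerDr alg_projD.
Qed.

Let scaleDl v : {morph scale^~ v : a b / a + b}.
Proof.
by move=> a b; rewrite -[v]alg_projK !projZ scalerDl alg_projD.
Qed.

HB.instance Definition _ :=
  GRing.Zmodule_isLmodule.Build K Q scaleA scale1 scaleDr scaleDl.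

Lemma alg_projZ c x : alg_proj (c *: x) = c *: alg_proj x.
Proof. by rewrite -projZ. Qed.

Let scaleAl (c : K) (x y : Q) : c *: (x * y) = (c *: x) * y.
Proof.
rewrite -[x]alg_projK -[y]alg_projK.
by rewrite -alg_projM -!alg_projZ -alg_projM scalerAl.
Qed.

HB.instance Definition _ := GRing.Lmodule_isLalgebra.Build K Q scaleAl.

Let scaleAr (c : K) (x y : Q) : c *: (x * y) = x * (c *: y).
Proof.
rewrite -[x]alg_projK -[y]alg_projK.
by rewrite -alg_projM -!alg_projZ -alg_projM scalerAr.
Qed.

HB.instance Definition _ := GRing.Lalgebra_isAlgebra.Build K Q scaleAr.

Let proj_zmod : zmod_morphism alg_proj.
Proof.
by move=> x y; apply: (addIr (alg_proj y)); rewrite subrK -alg_projD subrK.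
Qed.

Let proj_monoid : monoid_morphism alg_proj.
Proof. by split=> //; exact: alg_projM. Qed.

HB.instance Definition _ := GRing.isZmodMorphism.Build A Q alg_proj proj_zmod.
HB.instance Definition _ :=
  GRing.isMonoidMorphism.Build A Q alg_proj proj_monoid.
HB.instance Definition _ :=
  GRing.isScalable.Build K A Q *:%R alg_proj alg_projZ.

Lemma alg_proj_rel x : S x -> alg_proj x = 0.
Proof.
move=> Sx; rewrite -(rmorph0 alg_proj); apply/alg_projP; rewrite subr0.
by rewrite -[x]mulr1 -[x]mul1r; exact: IdealG.
Qed.

End AlgQuotient.

(* The free associative unital K-algebra on two generators: finitely supported
   K-valued functions on the free monoid of words in 0, 1. *)
Definition free_alg (K : fieldType) : Type := {malg K[{fmonom 'I_2}]}.

Section FreeAlgebra.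
Variable K : fieldType.

HB.instance Definition _ := GRing.Lalgebra.on (free_alg K).

Let free_scaleAr (c : K) (x y : free_alg K) : c *: (x * y) = x * (c *: y).
Proof.
have comm_c (z : {malg K[{fmonom 'I_2}]}) : c *: z = z * c%:MP.
  rewrite malgM_def fgmulgU malgZ_def; apply: eq_bigr => k _.
  by rewrite mulm1 mulrC.
by rewrite !comm_c mulrA.
Qed.

HB.instance Definition _ :=
  GRing.Lalgebra_isAlgebra.Build K (free_alg K) free_scaleAr.

Definition free_gen (i : 'I_2) : free_alg K := << fmu i >>.

End FreeAlgebra.

(* The algebra presented by generators x_0, x_1 and relations r = 0, r in S. *)
Definition presented (K : fieldType) (S : free_alg K -> Prop)
  (properS : ~ ideal_gen S 1) : algType K := alg_quot properS.

Definition presented_gen (K : fieldType) (S : free_alg K -> Prop)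
    (properS : ~ ideal_gen S 1) (i : 'I_2) : presented properS :=
  alg_proj properS (free_gen K i).

Definition const_coef (K : fieldType) (x : free_alg K) : K :=
  mcoeff (mone : {fmonom 'I_2}) (x : {malg K[{fmonom 'I_2}]}).

HB.instance Definition _ (K : fieldType) :=
  GRing.RMorphism.copy (@const_coef K)
    (mcoeff mone : {malg K[{fmonom 'I_2}]} -> K).

(* Relators without constant term generate a proper ideal. *)
Lemma ideal_gen_proper (K : fieldType) (S : free_alg K -> Prop) :
  (forall x, S x -> const_coef x = 0) -> ~ ideal_gen S 1.
Proof.
move=> S0; have H x : ideal_gen S x -> const_coef x = 0.
  elim=> [|a s b /S0 Ss|u v _ Hu _ Hv]; first exact: rmorph0.
    by rewrite !rmorphM /= Ss mulr0 mul0r.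
  by rewrite rmorphD /= Hu Hv addr0.
by move/H/eqP; rewrite rmorph1 oner_eq0.
Qed.

Section PresentedAlgebras.
Variable K : fieldType.
Local Notation x0 := (free_gen K ord0).
Local Notation x1 := (free_gen K ord_max).

Lemma const_coef_comr (X Y : free_alg K) : const_coef [: X, Y :] = 0.
Proof.
apply: etrans (rmorphB (@const_coef K) (X * Y) (Y * X)) _.
apply/eqP; rewrite subr_eq0; apply/eqP.
apply: etrans (rmorphM (@const_coef K) X Y) _.
by apply: etrans (esym (rmorphM (@const_coef K) Y X)); exact: mulrC.
Qed.

Lemma const_coef_qDG alpha (X Y Z : free_alg K) :
  const_coef ([: X, Y :] - alpha *: [: X, Z :]) = 0.
Proof.
have cB (x y : free_alg K) :
    const_coef x = 0 -> const_coef y = 0 -> const_coef (x - y) = 0.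
  by move=> hx hy; rewrite rmorphB /= hx hy subrr.
have cZ c (x : free_alg K) : const_coef x = 0 -> const_coef (c *: x) = 0.
  by move=> hx; rewrite [LHS]mcoeffZ -/(const_coef x) hx mulr0.
exact: (cB _ _ (const_coef_comr _ _) (cZ _ _ (const_coef_comr _ _))).
Qed.

Inductive tridiag_relator (alpha alpha1 beta gamma gamma1 : K) :
    free_alg K -> Prop :=
| TDrelator0 : tridiag_relator alpha alpha1 beta gamma gamma1
    (tridiag beta gamma alpha x0 x1)
| TDrelator1 : tridiag_relator alpha alpha1 beta gamma gamma1
    (tridiag beta gamma1 alpha1 x1 x0).

Inductive qDG_relator (s alpha alpha1 : K) : free_alg K -> Prop :=
| DGrelator0 : qDG_relator s alpha alpha1
    ([: x0, qcomr s^-1 x0 (qcomr s x0 x1) :] - alpha *: [: x0, x1 :])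
| DGrelator1 : qDG_relator s alpha alpha1
    ([: x1, qcomr s^-1 x1 (qcomr s x1 x0) :] - alpha1 *: [: x1, x0 :]).

Lemma tridiag_proper (alpha alpha1 beta gamma gamma1 : K) :
  ~ ideal_gen (tridiag_relator alpha alpha1 beta gamma gamma1) 1.
Proof. by apply: ideal_gen_proper => _ []; exact: const_coef_comr. Qed.

Lemma qDG_proper (s alpha alpha1 : K) :
  ~ ideal_gen (qDG_relator s alpha alpha1) 1.
Proof.
by apply: ideal_gen_proper => _ []; exact: const_coef_qDG.
Qed.

Definition tridiag_alg (alpha alpha1 beta gamma gamma1 : K) : algType K :=
  presented (@tridiag_proper alpha alpha1 beta gamma gamma1).

Definition qDG_alg (s alpha alpha1 : K) : algType K :=
  presented (@qDG_proper s alpha alpha1).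

Definition tridiag_gen (alpha alpha1 beta gamma gamma1 : K) (i : 'I_2) :
    tridiag_alg alpha alpha1 beta gamma gamma1 :=
  presented_gen _ i.

Definition qDG_gen (s alpha alpha1 : K) (i : 'I_2) : qDG_alg s alpha alpha1 :=
  presented_gen _ i.

Lemma tridiag_genP alpha alpha1 beta gamma gamma1 :
  tridiag_rels alpha alpha1 beta gamma gamma1
    (tridiag_gen alpha alpha1 beta gamma gamma1 ord0)
    (tridiag_gen alpha alpha1 beta gamma gamma1 ord_max).
Proof.
pose p := alg_proj (@tridiag_proper alpha alpha1 beta gamma gamma1).
split.
  apply: etrans (esym (lrmorph_tridiag p _ _ _ x0 x1)) _.
  exact/alg_proj_rel/TDrelator0.
apply: etrans (esym (lrmorph_tridiag p _ _ _ x1 x0)) _.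
exact/alg_proj_rel/TDrelator1.
Qed.

Lemma qDG_genP s alpha alpha1 :
  qDG_rels s alpha alpha1 (qDG_gen s alpha alpha1 ord0)
    (qDG_gen s alpha alpha1 ord_max).
Proof.
pose p := alg_proj (@qDG_proper s alpha alpha1).
have E a X Y : p ([: X, qcomr s^-1 X (qcomr s X Y) :] - a *: [: X, Y :]) =
    [: p X, qcomr s^-1 (p X) (qcomr s (p X) (p Y)) :] - a *: [: p X, p Y :].
  rewrite -!lrmorph_qcomr -!lrmorph_comr -lrmorph_scale.
  exact: (rmorphB p).
split; apply/subr0_eq.
  by apply: etrans (esym (E _ x0 x1)) _; exact/alg_proj_rel/DGrelator0.
by apply: etrans (esym (E _ x1 x0)) _; exact/alg_proj_rel/DGrelator1.
Qed.

End PresentedAlgebras.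

(* Main.v *)
(* Write L for left multiplication by X and D for [X, .].  These operators
   commute and right multiplication by X is L - D, so every commutator of X with
   a combination of the X^i Y X^j is a multiple of D in K[L, D], applied to Y.
   For the tridiagonal relation it is
   D^3 - (2 - beta)(L D^2 - L^2 D) - 2 gamma L D + gamma D^2 - alpha D. *)
Require Import Defs.
From mathcomp Require Import all_boot all_order all_algebra.
From mathcomp Require Import reals complex.

Import GRing.Theory.

Local Open Scope ring_scope.
Local Open Scope complex_scope.

(** * Calculus of [[: X, _ :]] in a ring *)

Section Commutator.
Set Implicit Arguments.
Unset Strict Implicit.
Variable A : pzRingType.
Implicit Types X Y Z : A.

Lemma comrD X Y Z : [: X, Y + Z :] = [: X, Y :] + [: X, Z :].
Proof. by rewrite /comr mulrDl mulrDr opprD addrACA. Qed.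

Lemma comrN X Y : [: X, - Y :] = - [: X, Y :].
Proof. by rewrite /comr mulrN mulNr opprB opprK addrC. Qed.

Lemma comrB X Y Z : [: X, Y - Z :] = [: X, Y :] - [: X, Z :].
Proof. by rewrite comrD comrN. Qed.

(** As [X] commutes with itself, the other term of the Leibniz rule vanishes. *)
Lemma comr_mull X Y : [: X, X * Y :] = X * [: X, Y :].
Proof. by rewrite /comr mulrBr !mulrA. Qed.

Lemma comr_mulr X Y : [: X, Y * X :] = [: X, Y :] * X.
Proof. by rewrite /comr mulrBl !mulrA. Qed.

Lemma comr_antisym X Y : [: X, Y :] = - [: Y, X :].
Proof. by rewrite /comr opprB. Qed.

Lemma mulr_comr X Y : Y * X = X * Y - [: X, Y :].
Proof. by rewrite /comr opprB addrC subrK. Qed.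

(** In the operators L and D this is L^2 + (L - D)^2 = D^2 - 2 (L D - L^2). Applied to [[: X, Y :]],
    it produces the 2 of the factor 2 - beta. *)
Lemma mulr_comr2 X Y :
  X ^+ 2 * Y + Y * X ^+ 2
  = [: X, [: X, Y :] :] - (X * [: X, Y :] - X ^+ 2 * Y) *+ 2.
Proof.
rewrite expr2 mulrA (mulr_comr X Y) mulrBl (mulr_comr X [: X, Y :]).
rewrite -[X * Y * X]mulrA (mulr_comr X Y) mulrBr !mulrA.
move: (X * X * Y) (X * [: X, Y :]) [: X, [: X, Y :] :] => a b c.
rewrite mulrnBl [in RHS]opprB (addrCA c) opprB !addrA -mulr2n.
by rewrite -!addrA (addrCA (- b)) -opprD -mulr2n.
Qed.

End Commutator.

(** * Tridiagonal, cubic and q-deformed Dolan-Grady relations *)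

Section TridiagonalRelation.
Set Implicit Arguments.
Unset Strict Implicit.
Variables (K : fieldType) (A : algType K).
Implicit Types (c : K) (X Y Z : A).

Lemma comrZ c X Y : [: X, c *: Y :] = c *: [: X, Y :].
Proof. by rewrite /comr -scalerAl -scalerAr scalerBr. Qed.

Definition cubic_rhs (beta gamma alpha : K) X Y : A :=
  (2%:R - beta) *: (X * [: X, [: X, Y :] :] - X ^+ 2 * [: X, Y :])
    + (2%:R * gamma) *: (X * [: X, Y :]) - gamma *: [: X, [: X, Y :] :]
    + alpha *: [: X, Y :].

Lemma tridiagE (beta gamma alpha : K) X Y :
  tridiag beta gamma alpha X Y =
  [: X, [: X, [: X, Y :] :] :] - cubic_rhs beta gamma alpha X Y.
Proof.
rewrite /tridiag 3!comrB !comrZ.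
have -> : [: X, X ^+ 2 * Y + Y * X ^+ 2 :]
    = X ^+ 2 * [: X, Y :] + [: X, Y :] * X ^+ 2.
  by rewrite comrD expr2 -mulrA !comr_mull !mulrA !comr_mulr.
have -> : [: X, X * Y * X :] = X ^+ 2 * [: X, Y :] - X * [: X, [: X, Y :] :].
  by rewrite comr_mulr comr_mull -mulrA (mulr_comr X [: X, Y :]) mulrBr mulrA.
have -> : [: X, X * Y + Y * X :] = (X * [: X, Y :]) *+ 2 - [: X, [: X, Y :] :].
  by rewrite comrD comr_mull comr_mulr (mulr_comr X [: X, Y :]) addrA.
rewrite mulr_comr2 /cubic_rhs.
move: [: X, [: X, [: X, Y :] :] :] (X ^+ 2 * _) (X * _) (X * _) => D3 p q r.
move: [: X, Y :] [: X, [: X, Y :] :] => D1 D2.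
(* What remains is linear in the monomials. With t = L D^2 Y - L^2 D Y, the squares contribute -2 t
   and the [beta] term + beta t, hence -(2 - beta) t. *)
rewrite -(opprB r p) scalerN opprK; move: (r - p) => t.
rewrite scalerBl scaler_nat scalerBr -scalerMnr mulr_natl -scalerMnl.
by rewrite !opprD !opprK !addrA.
Qed.

Lemma tridiag_eq0 (beta gamma alpha : K) X Y :
  tridiag beta gamma alpha X Y = 0 <->
  [: X, [: X, [: X, Y :] :] :] = cubic_rhs beta gamma alpha X Y.
Proof. by rewrite tridiagE; split=> [/subr0_eq|->] //; rewrite subrr. Qed.

(** For X = A1 and Y = A0 the theorem uses A2 = [A0, A1], which is -[A1, A0]; every term in A2
    therefore changes sign. *)
Lemma cubic_rhs_antisym (beta gamma alpha : K) X Y :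
  cubic_rhs beta gamma alpha X Y =
  (2%:R - beta) *: (X * [: X, [: X, Y :] :] + X ^+ 2 * [: Y, X :])
    - (2%:R * gamma) *: (X * [: Y, X :]) - gamma *: [: X, [: X, Y :] :]
    - alpha *: [: Y, X :].
Proof.
by rewrite /cubic_rhs (comr_antisym Y X) !mulrN !scalerN !opprK.
Qed.

(** The weights s and s^-1 cancel on the two outer monomials, while X Y X collects s^2 and s^-2.
    With s^2 = q this is beta = q + q^-1. *)
Lemma qcomr_qcomr (s : K) X Y : s != 0 ->
  qcomr s^-1 X (qcomr s X Y)
  = X ^+ 2 * Y + Y * X ^+ 2 - (s ^+ 2 + (s ^+ 2)^-1) *: (X * Y * X).
Proof.
move=> s0; rewrite /qcomr invrK !mulrBr !mulrBl -!scalerAr -!scalerAl !scalerBr.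
rewrite !scalerA mulVf // mulfV // !scale1r !mulrA -!expr2 -(mulrA Y) -expr2.
by rewrite opprB addrACA -opprD -scalerDl exprVn (addrC (s ^- 2)).
Qed.

Lemma tridiag_qDG (s alpha : K) X Y : s != 0 ->
  tridiag (s ^+ 2 + (s ^+ 2)^-1) 0 alpha X Y =
  [: X, qcomr s^-1 X (qcomr s X Y) :] - alpha *: [: X, Y :].
Proof. by move=> s0; rewrite qcomr_qcomr // /tridiag scale0r subr0 comrB comrZ. Qed.

Lemma tridiag_rels_qDG (s alpha alpha1 : K) X Y : s != 0 ->
  tridiag_rels alpha alpha1 (s ^+ 2 + (s ^+ 2)^-1) 0 0 X Y
  <-> qDG_rels s alpha alpha1 X Y.
Proof.
move=> s0; rewrite /tridiag_rels !tridiag_qDG //.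
by split=> -[E F]; split; do ?exact: subr0_eq; rewrite ?E ?F subrr.
Qed.

(** * Quasi-linearity *)

Lemma quasi_linear_formN X Y1 Y2 Y3 Z :
  quasi_linear_form X Y1 Y2 Y3 Z -> quasi_linear_form X Y1 Y2 Y3 (- Z).
Proof.
case=> p0 [p1 [p2 [p3 ->]]]; exists (- p0), (- p1), (- p2), (- p3).
by rewrite !rmorphN !mulNr -!opprD.
Qed.

(** Both halves of [quasi_linear23] share A2 = [A0, A1], but the half for A1 naturally yields
    [A1, A0]; the sign is absorbed into the polynomial [p2]. *)
Lemma quasi_linear_form_opp2 X Y1 Y2 Y3 Z :
  quasi_linear_form X Y1 Y2 Y3 Z -> quasi_linear_form X Y1 (- Y2) Y3 Z.
Proof.
case=> p0 [p1 [p2 [p3 ->]]]; exists p0, p1, (- p2), p3.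
by rewrite rmorphN mulrNN.
Qed.

Lemma quasi_linear_form2 X Y1 Y2 Y3 : quasi_linear_form X Y1 Y2 Y3 Y2.
Proof.
by exists 0, 0, 1, 0; rewrite !rmorph0 rmorph1 !mul0r mul1r add0r !addr0.
Qed.

Lemma quasi_linear_form3 X Y1 Y2 Y3 : quasi_linear_form X Y1 Y2 Y3 Y3.
Proof.
by exists 0, 0, 0, 1; rewrite !rmorph0 rmorph1 !mul0r mul1r !add0r addr0.
Qed.

Lemma quasi_linear_form_cubic (beta gamma alpha : K) X Y Y1 :
  quasi_linear_form X Y1 [: X, Y :] [: X, [: X, Y :] :]
    (cubic_rhs beta gamma alpha X Y).
Proof.
(* The last two witnesses are the coefficients of [[: X, Y :]] and [[: X, [: X, Y :] :]] in
   [cubic_rhs], read as polynomials in [X]. *)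
exists 0, 0, (- (2%:R - beta) *: 'X^2 + (2%:R * gamma) *: 'X + alpha%:P),
  ((2%:R - beta) *: 'X - gamma%:P).
rewrite !rmorph0 mul0r add0r addr0 rmorphB !rmorphD /= !linearZ /=.
rewrite rmorphXn /= horner_algX !horner_algC !mulrDl mulNr -!scalerAl !mul1r.
rewrite /cubic_rhs scalerBr scaleNr.
rewrite -mulr2n mulr_natl [RHS]addrC !addrA [in RHS](addrAC _ _ (- _)).
by rewrite [in RHS](addrAC _ (- (gamma *: _))).
Qed.

(** In each half the first two commutators are extension operators up to sign; only the third uses a
    relation, in its cubic form. *)
Lemma tridiag_rels_quasi_linear23 (alpha alpha1 beta gamma gamma1 : K) X Y :
  tridiag_rels alpha alpha1 beta gamma gamma1 X Y ->
  quasi_linear23 X Y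
    [: X, Y :] [: X, [: X, Y :] :] [: Y, [: Y, X :] :].
Proof.
case=> /tridiag_eq0 EX /tridiag_eq0 EY; split; split.
- exact: quasi_linear_form2.
- exact: quasi_linear_form3.
- rewrite EX; exact: quasi_linear_form_cubic.
- by rewrite (comr_antisym X Y); apply/quasi_linear_form_opp2/quasi_linear_form2.
- rewrite (comr_antisym X Y) comrN.
  exact/quasi_linear_formN/quasi_linear_form3.
- rewrite EY (comr_antisym X Y).
  exact/quasi_linear_form_opp2/quasi_linear_form_cubic.
Qed.

End TridiagonalRelation.

Theorem mainTheorem4 (R : realType) (alpha alpha1 beta gamma gamma1 : R[i]) :
  (forall (A : algType R[i]) (A0 A1 : A),
    let A2 := [: A0, A1 :] in
    let A3 := [: A0, [: A0, A1 :] :] in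
    let A4 := [: A1, [: A1, A0 :] :] in
    [/\
        ([: A0, A0 ^+ 2 * A1 + A1 * A0 ^+ 2 - beta *: (A0 * A1 * A0)
                - gamma *: (A0 * A1 + A1 * A0) - alpha *: A1 :] = 0 /\
         [: A1, A1 ^+ 2 * A0 + A0 * A1 ^+ 2 - beta *: (A1 * A0 * A1)
                - gamma1 *: (A0 * A1 + A1 * A0) - alpha1 *: A0 :] = 0)
        <->
        ([: A0, [: A0, [: A0, A1 :] :] :] =
           (2%:R - beta) *: (A0 * A3 - A0 ^+ 2 * A2)
             + (2%:R * gamma) *: (A0 * A2) - gamma *: A3 + alpha *: A2 /\
         [: A1, [: A1, [: A1, A0 :] :] :] =
           (2%:R - beta) *: (A1 * A4 + A1 ^+ 2 * A2)
             - (2%:R * gamma1) *: (A1 * A2) - gamma1 *: A4 - alpha1 *: A2),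
        tridiag_rels alpha alpha1 beta gamma gamma1 A0 A1 ->
          quasi_linear23 A0 A1 A2 A3 A4 &
        forall q s : R[i], q != 0 -> s ^+ 2 = q ->
          gamma = 0 -> gamma1 = 0 -> beta = q + q^-1 ->
          (tridiag_rels alpha alpha1 beta gamma gamma1 A0 A1 <->
             qDG_rels s alpha alpha1 A0 A1) /\
          (qDG_rels s alpha alpha1 A0 A1 -> quasi_linear23 A0 A1 A2 A3 A4)])
  /\
  (let A0 := tridiag_gen alpha alpha1 beta gamma gamma1 ord0 in
   let A1 := tridiag_gen alpha alpha1 beta gamma gamma1 ord_max in
   quasi_linear23 A0 A1
     [: A0, A1 :] [: A0, [: A0, A1 :] :] [: A1, [: A1, A0 :] :])
  /\
  (forall q s : R[i], q != 0 -> s ^+ 2 = q ->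
   let A0 := qDG_gen s alpha alpha1 ord0 in
   let A1 := qDG_gen s alpha alpha1 ord_max in
   quasi_linear23 A0 A1
     [: A0, A1 :] [: A0, [: A0, A1 :] :] [: A1, [: A1, A0 :] :]).
Proof.
have sqr_neq0 (q s : R[i]) : q != 0 -> s ^+ 2 = q -> s != 0.
  by move=> q0 sq; apply: contra_neq q0 => s0; rewrite -sq s0 expr0n.
split; last split.
- move=> A A0 A1 A2 A3 A4; split.
  + have EX := tridiag_eq0 beta gamma alpha A0 A1.
    have EY := tridiag_eq0 beta gamma1 alpha1 A1 A0.
    (* The [gamma1] term is stated as A0 A1 + A1 A0, whereas [tridiag] with the operators exchanged
       has A1 A0 + A0 A1. *)
    rewrite cubic_rhs_antisym in EY; rewrite {2}(addrC (A0 * A1)).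
    by split=> -[/EX E /EY F].
  + exact: tridiag_rels_quasi_linear23.
  + move=> q s q0 sq -> -> ->; have s0 := sqr_neq0 q s q0 sq.
    have E := tridiag_rels_qDG alpha alpha1 A0 A1 s0.
    rewrite -sq; split=> // /E; exact: tridiag_rels_quasi_linear23.
- exact/tridiag_rels_quasi_linear23/tridiag_genP.
- move=> q s q0 sq A0 A1; apply: tridiag_rels_quasi_linear23.
  (* The generators satisfy the tridiagonal relations with beta = s^2 + s^-2 and both gammas
     zero. *)
  exact/(tridiag_rels_qDG alpha alpha1 A0 A1 (sqr_neq0 q s q0 sq))/qDG_genP.
Qed.
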